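(* Let $K$ be a field. Then $[\mathscr T_K,\mathscr T_K]=F$.
   Context: Let $K$ be a field. The algebraic Toeplitz algebra $\mathscr T_K$ is the Leavitt path algebra over $K$ of the graph with two vertices $v,w$ and two edges, $e$ from $v$ to $v$ and $f$ from $v$ to $w$. Concretely, it is the associative unital $K$-algebra generated by $v,w,e,f,e^*,f^*$ subject to: $1=v+w$; $v^2=v$, $w^2=w$, $vw=wv=0$; $ve=ev=e$, $vf=fw=f$, $ve^*=e^*v=e^*$, $wf^*=f^*v=f^*$; $e^*e=v$, $f^*f=w$, $e^*f=f^*e=0$; $v=ee^*+ff^*$. $F=I(w)$ is the two-sided ideal of $\mathscr T_K$ generated by $w$. With $[a,b]=ab-ba$, $[\mathscr T_K,\mathscr T_K]$ denotes the $K$-span of all commutators $[a,b]$, $a,b\in\mathscr T_K$. *)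

(* Defs.v *)
From HB Require Import structures.
From mathcomp Require Import all_boot all_algebra.
From mathcomp Require Import boolp classical_sets.
From mathcomp Require Import finmap monalg.

Set Implicit Arguments.
Unset Strict Implicit.
Unset Printing Implicit Defensive.

Import GRing.Theory Quotient.

Local Open Scope classical_set_scope.
Local Open Scope ring_scope.
Local Open Scope quotient_scope.

(* Over a unital K-algebra these ideals are automatically K-subspaces, and
   closure under opposite is the case a = -1 of closure under multiplication *)
Definition two_sided_ideal (A : nzRingType) (I : set A) : Prop :=
  [/\ I 0, (forall x y, I x -> I y -> I (x + y)),
      (forall a x, I x -> I (a * x)) & (forall a x, I x -> I (x * a))].

Definition ideal_gen (A : nzRingType) (S : set A) : set A :=
  smallest (@two_sided_ideal A) S.

Definition lspan (K : fieldType) (V : lmodType K) (S : set V) : set V :=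
  [set x | exists n (c : 'I_n -> K) (s : 'I_n -> V),
     (forall i, S (s i)) /\ x = \sum_i c i *: s i].

Definition commutators (A : nzRingType) : set A :=
  [set x | exists a b, x = a * b - b * a].
Arguments commutators A : clear implicits.

Lemma ideal_genP (A : nzRingType) (S : set A) : two_sided_ideal (ideal_gen S).
Proof.
split=> [I [[]]//|x y Ix Iy I HI|a x Ix I HI|a x Ix I HI].
- by have [[_ ID _ _] _] := HI; apply: ID; [apply: Ix|apply: Iy].
- by have [[_ _ IM _] _] := HI; apply: IM; apply: Ix.
- by have [[_ _ _ IM] _] := HI; apply: IM; apply: Ix.
Qed.

(* Ges and Gfs are the ghost edges e^* and f^* *)
Inductive tgen := Gv | Gw | Ge | Gf | Ges | Gfs.

Definition tgen_code (x : tgen) : 'I_6 :=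
  inord (match x with Gv => 0 | Gw => 1 | Ge => 2 | Gf => 3 | Ges => 4 | Gfs => 5
         end).
Definition tgen_decode (i : 'I_6) : tgen :=
  match val i with
  | 0 => Gv | 1 => Gw | 2 => Ge | 3 => Gf | 4 => Ges | _ => Gfs end%N.
Lemma tgen_codeK : cancel tgen_code tgen_decode.
Proof. by case; rewrite /tgen_decode /tgen_code /= inordK. Qed.

HB.instance Definition _ := Finite.copy tgen (can_type tgen_codeK).

(* The free associative unital K-algebra on tgen, realized as the algebra of
   the free monoid on tgen *)
Definition tfree (K : fieldType) := {malg K[{fmonom tgen}]}.
HB.instance Definition _ (K : fieldType) := GRing.Lalgebra.on (tfree K).

Definition tvar (K : fieldType) (x : tgen) : tfree K := << fmu x >>.

Inductive trelation (K : fieldType) : tfree K -> tfree K -> Prop :=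
  | rel_1 : trelation 1 (tvar K Gv + tvar K Gw)
  | rel_vv : trelation (tvar K Gv * tvar K Gv) (tvar K Gv)
  | rel_ww : trelation (tvar K Gw * tvar K Gw) (tvar K Gw)
  | rel_vw : trelation (tvar K Gv * tvar K Gw) 0
  | rel_wv : trelation (tvar K Gw * tvar K Gv) 0
  | rel_ve : trelation (tvar K Gv * tvar K Ge) (tvar K Ge)
  | rel_ev : trelation (tvar K Ge * tvar K Gv) (tvar K Ge)
  | rel_vf : trelation (tvar K Gv * tvar K Gf) (tvar K Gf)
  | rel_fw : trelation (tvar K Gf * tvar K Gw) (tvar K Gf)
  | rel_ves : trelation (tvar K Gv * tvar K Ges) (tvar K Ges)
  | rel_esv : trelation (tvar K Ges * tvar K Gv) (tvar K Ges)
  | rel_wfs : trelation (tvar K Gw * tvar K Gfs) (tvar K Gfs)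
  | rel_fsv : trelation (tvar K Gfs * tvar K Gv) (tvar K Gfs)
  | rel_ese : trelation (tvar K Ges * tvar K Ge) (tvar K Gv)
  | rel_fsf : trelation (tvar K Gfs * tvar K Gf) (tvar K Gw)
  | rel_esf : trelation (tvar K Ges * tvar K Gf) 0
  | rel_fse : trelation (tvar K Gfs * tvar K Ge) 0
  | rel_v : trelation (tvar K Gv)
      (tvar K Ge * tvar K Ges + tvar K Gf * tvar K Gfs).

Definition trelators (K : fieldType) : set (tfree K) :=
  [set x | exists l r, trelation l r /\ x = l - r].

Definition trel_ideal (K : fieldType) : set (tfree K) :=
  ideal_gen (@trelators K).

Definition trel_pred (K : fieldType) : {pred tfree K} :=
  fun x => `[< trel_ideal x >].

Section Toeplitz.
Variable K : fieldType.
Local Notation A := (tfree K).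
Local Notation tI := (@trel_pred K).

Lemma trel_predP x : reflect (trel_ideal x) (x \in tI).
Proof. exact: asboolP. Qed.

Lemma trel_zmod_closed : zmod_closed tI.
Proof.
have [I0 ID IM _] := ideal_genP (@trelators K).
split; first exact/trel_predP.
move=> x y /trel_predP Ix /trel_predP Iy; apply/trel_predP; apply: ID => //.
by rewrite -mulN1r; apply: IM.
Qed.
HB.instance Definition _ := GRing.isZmodClosed.Build A tI trel_zmod_closed.

Lemma trelMl a x : x \in tI -> a * x \in tI.
Proof.
move=> /trel_predP Ix; apply/trel_predP.
by have [_ _ IM _] := ideal_genP (@trelators K);
  apply: IM.
Qed.

Lemma trelMr a x : x \in tI -> x * a \in tI.
Proof.
move=> /trel_predP Ix; apply/trel_predP.
by have [_ _ _ IM] := ideal_genP (@trelators K);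
  apply: IM.
Qed.

(* The ideal of relations is proper: it is killed by the character
   v, e, e^* |-> 1 and w, f, f^* |-> 0 of the free algebra. *)
Definition tchar_gen (x : tgen) : K :=
  match x with Gv | Ge | Ges => 1 | _ => 0 end.
Definition tchar_mon (m : {fmonom tgen}) : K :=
  \prod_(x <- fmonom_val m) tchar_gen x.
Lemma tchar_mon_mmorphism : mmorphism tchar_mon.
Proof.
split=> [m1 m2|]; rewrite /tchar_mon; first by rewrite fmM big_cat.
by rewrite fm1 big_nil.
Qed.
HB.instance Definition _ :=
  isMultiplicative.Build {fmonom tgen} K tchar_mon tchar_mon_mmorphism.
Definition tchar : A -> K := mmap idfun tchar_mon.
Lemma tchar0 : tchar 0 = 0. Proof. exact: mmap0. Qed.
Lemma tchar1 : tchar 1 = 1. Proof. exact: mmap1. Qed.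
Lemma tcharB : {morph tchar : x y / x - y}. Proof. exact: mmapB. Qed.
Lemma tcharD : {morph tchar : x y / x + y}. Proof. exact: mmapD. Qed.
Lemma tcharM : {morph tchar : x y / x * y}.
Proof. exact: (mmap_is_multiplicative (f := idfun) (h := tchar_mon)).1. Qed.

Lemma tchar_var x : tchar (tvar K x) = tchar_gen x.
Proof. by rewrite /tchar mmapU /= mul1r /tchar_mon fmU big_seq1. Qed.

Lemma trel1 : 1 \in tI = false.
Proof.
apply/negP => /trel_predP /(_ [set x | tchar x = 0]) /= I1.
suff: tchar 1 = 0 by rewrite tchar1 => /eqP; rewrite oner_eq0.
apply: I1; split; first split=> [|x y|a x|a x].
- by rewrite /= tchar0.
- by rewrite /= => x0 y0; rewrite tcharD x0 y0 addr0.
- by rewrite /= => x0; rewrite tcharM x0 mulr0.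
- by rewrite /= => x0; rewrite tcharM x0 mul0r.
move=> _ [l [r [lr ->]]] /=; case: lr;
  by rewrite !(tchar0, tchar1, tcharB, tcharD, tcharM, tchar_var) /=
    ?(mulr0, mul0r, mulr1, mul1r, addr0, subr0, subrr).
Qed.

(* The algebraic Toeplitz algebra: the quotient of the free algebra by the
   two-sided ideal generated by the relations *)
Definition toeplitz := quot (GRing.ZmodClosed.clone A tI _).
HB.instance Definition _ := GRing.Zmodule.on toeplitz.
HB.instance Definition _ := EqQuotient.on toeplitz.

Lemma toeplitz_eq (x y : A) : (\pi_toeplitz x == \pi_toeplitz y) = (x - y \in tI).
Proof. by rewrite piE equivE. Qed.

Lemma toeplitz_rel (l r : A) :
  trelation l r -> \pi_toeplitz l = \pi_toeplitz r.
Proof.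
move=> lr; apply/eqP; rewrite toeplitz_eq; apply/trel_predP => I [_].
by apply; exists l, r.
Qed.

Definition tone : toeplitz := \pi 1.
Definition tmul := lift_op2 toeplitz *%R.
Definition tscale (c : K) := lift_op1 toeplitz ( *:%R c).

Lemma pi_tmul : {morph \pi_toeplitz : x y / x * y >-> tmul x y}.
Proof.
move=> x y; unlock tmul; apply/eqP; rewrite toeplitz_eq.
rewrite -[_ * _](addrNK (x * repr (\pi_toeplitz y))) -mulrBr.
rewrite -addrA -mulrBl rpredD //.
  by apply: trelMl; rewrite -toeplitz_eq reprK.
by apply: trelMr; rewrite -toeplitz_eq reprK.
Qed.

Lemma pi_tscale c : {morph \pi_toeplitz : x / c *: x >-> tscale c x}.
Proof.
move=> x; unlock tscale; apply/eqP; rewrite toeplitz_eq -scalerBr.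
by rewrite -mul_malgC; apply: trelMl; rewrite -toeplitz_eq reprK.
Qed.

Lemma pi_tD : {morph \pi_toeplitz : x y / x + y >-> x + y}.
Proof. exact: pi_add. Qed.

Lemma tmulA : associative tmul.
Proof. by move=> x y z; rewrite -[x]reprK -[y]reprK -[z]reprK -!pi_tmul mulrA. Qed.
Lemma tmul1 : left_id tone tmul.
Proof. by move=> x; rewrite -[x]reprK -!pi_tmul mul1r. Qed.
Lemma tmulr1 : right_id tone tmul.
Proof. by move=> x; rewrite -[x]reprK -!pi_tmul mulr1. Qed.
Lemma tmulDl : left_distributive tmul +%R.
Proof.
move=> x y z; rewrite -[x]reprK -[y]reprK -[z]reprK.
by rewrite -pi_tD -!pi_tmul mulrDl pi_tD.
Qed.
Lemma tmulDr : right_distributive tmul +%R.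
Proof.
move=> x y z; rewrite -[x]reprK -[y]reprK -[z]reprK.
by rewrite -pi_tD -!pi_tmul mulrDr pi_tD.
Qed.
Lemma tone_neq0 : tone != 0.
Proof.
have -> : 0 = \pi_toeplitz 0 by rewrite /GRing.zero /= /zero; unlock.
by rewrite toeplitz_eq subr0 trel1.
Qed.
HB.instance Definition _ := GRing.Zmodule_isNzRing.Build toeplitz
  tmulA tmul1 tmulr1 tmulDl tmulDr tone_neq0.

Lemma tscaleA a b x : tscale a (tscale b x) = tscale (a * b) x.
Proof. by rewrite -[x]reprK -!pi_tscale scalerA. Qed.
Lemma tscale1 : left_id 1 tscale.
Proof. by move=> x; rewrite -[x]reprK -!pi_tscale scale1r. Qed.
Lemma tscaleDr : right_distributive tscale +%R.
Proof.
move=> a x y; rewrite -[x]reprK -[y]reprK.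
by rewrite -pi_tD -!pi_tscale scalerDr pi_tD.
Qed.
Lemma tscaleDl x : {morph tscale^~ x : a b / a + b}.
Proof. by move=> a b; rewrite -[x]reprK -!pi_tscale scalerDl pi_tD. Qed.
HB.instance Definition _ := GRing.Zmodule_isLmodule.Build K toeplitz
  tscaleA tscale1 tscaleDr tscaleDl.

Lemma tscaleAl (a : K) (x y : toeplitz) : a *: (x * y) = (a *: x) * y.
Proof.
rewrite -[x]reprK -[y]reprK; change (tscale a (tmul (\pi_toeplitz (repr x)) (\pi_toeplitz (repr y)))
  = tmul (tscale a (\pi_toeplitz (repr x))) (\pi_toeplitz (repr y))).
by rewrite -!(pi_tmul, pi_tscale) -scalerAl.
Qed.
HB.instance Definition _ := GRing.Lmodule_isLalgebra.Build K toeplitz tscaleAl.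

Lemma malgC_central (a : K) (x : A) : x * a%:MP = a%:MP * x.
Proof.
rewrite [x]monalgE mulr_suml mulr_sumr; apply: eq_bigr => m _.
rewrite /malgC /GRing.mul /= !fgmulUU.
by rewrite mulrC; congr << _ *g _ >>; rewrite mulm1 mul1m.
Qed.

Lemma tscaleAr (a : K) (x y : toeplitz) : a *: (x * y) = x * (a *: y).
Proof.
rewrite -[x]reprK -[y]reprK; change (tscale a (tmul (\pi_toeplitz (repr x)) (\pi_toeplitz (repr y)))
  = tmul (\pi_toeplitz (repr x)) (tscale a (\pi_toeplitz (repr y)))).
rewrite -!(pi_tmul, pi_tscale) -!mul_malgC mulrA -malgC_central.
by rewrite -malgC_central -!mulrA malgC_central.
Qed.
HB.instance Definition _ := GRing.Lalgebra_isAlgebra.Build K toeplitz tscaleAr.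

End Toeplitz.

Definition toeplitz_gen (K : fieldType) (x : tgen) : toeplitz K :=
  \pi_(toeplitz K) (tvar K x).

(* Main.v *)
Require Import Defs.
From mathcomp Require Import all_boot all_algebra.
From mathcomp Require Import finmap monalg.
From mathcomp Require Import boolp classical_sets.

Import GRing.Theory.

Local Open Scope classical_set_scope.
Local Open Scope ring_scope.

(** Modulo [F = I(w)] the relations become [v = 1], [f = f^* = 0] and
    [e e^* = e^* e = 1], so the quotient by [F] is the Laurent polynomial
    algebra in [e].  It is commutative, hence every commutator lies in [F]
    ([commutator_in_ideal_w]).

    Conversely [w = [f^*, f] + [e^*, e]], because [f f^* + e e^* = v = e^* e].
    Modulo commutators products may be permuted cyclically, so an element
    [a w b] of [F] is congruent to [w (b a) w]; and the corner [w T w] is just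
    the line [K w] ([corner_w]), since [w] is a sink of the graph with no closed
    path through it.  Hence [a w b] is a sum of commutators as well. *)

(** * Spans and ideals *)

Section Span.
Context {K : fieldType} {V : lmodType K}.
Implicit Types (S P : set V) (x y : V).

Lemma lspan0 S : lspan S 0.
Proof.
exists 0%N, (fun=> 0), (fun=> 0); split; first by case.
by rewrite big_ord0.
Qed.

Lemma lspanD S x y : lspan S x -> lspan S y -> lspan S (x + y).
Proof.
move=> [m [c [s [Ss ->]]]] [n [d [t [St ->]]]].
exists (m + n)%N, (fun i => match split i with inl j => c j | inr j => d j end).
exists (fun i => match split i with inl j => s j | inr j => t j end).
split=> [i|]; first by case: (split i).
rewrite big_split_ord; congr (_ + _); apply: eq_bigr => i _.
  by rewrite (unsplitK (inl i)).
by rewrite (unsplitK (inr i)).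
Qed.

Lemma lspanZ S (a : K) x : lspan S x -> lspan S (a *: x).
Proof.
move=> [n [c [s [Ss ->]]]]; exists n, (fun i => a * c i), s; split=> //.
by rewrite scaler_sumr; apply: eq_bigr => i _; rewrite scalerA.
Qed.

Lemma sub_lspan S : S `<=` lspan S.
Proof.
move=> x Sx; exists 1%N, (fun=> 1), (fun=> x).
by split=> //; rewrite big_ord1 scale1r.
Qed.

Lemma lspan_min S P : P 0 -> (forall x y, P x -> P y -> P (x + y)) ->
  (forall (a : K) x, P x -> P (a *: x)) -> S `<=` P -> lspan S `<=` P.
Proof.
move=> P0 PD PZ SP x [n [c [s [Ss ->]]]].
by elim/big_ind: _ => // i _; apply/PZ/SP.
Qed.

End Span.

Section Ideal.
Context {A : nzRingType} {I : set A} (idI : two_sided_ideal I).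
Implicit Types x y z : A.

Lemma idealN x : I x -> I (- x).
Proof. by move=> Ix; rewrite -mulN1r; case: idI => _ _ IM _; exact: IM. Qed.

Lemma idealB x y : I x -> I y -> I (x - y).
Proof. by move=> Ix /idealN Iy; case: idI => _ ID _ _; exact: ID. Qed.

Lemma ideal_commutator x y : I x -> I (x * y - y * x).
Proof.
by move=> Ix; case: idI => _ _ IMl IMr; apply: idealB; [apply: IMr|apply: IMl].
Qed.

(** Commuting with [x] modulo [I] can be tested factor by factor, because the
    commutator with [x] is a derivation. *)
Lemma ideal_commutatorM x y z : I (x * y - y * x) -> I (x * z - z * x) ->
  I (x * (y * z) - y * z * x).
Proof.
move=> Iy Iz; case: idI => _ ID IMl IMr.
have -> : x * (y * z) - y * z * x
        = (x * y - y * x) * z + y * (x * z - z * x).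
  by rewrite mulrBl mulrBr !mulrA subrKA.
by apply: ID; [apply: IMr|apply: IMl].
Qed.

End Ideal.

Lemma ideal_gen_sub (A : nzRingType) (S : set A) : S `<=` ideal_gen S.
Proof. by move=> x Sx I [_]; apply. Qed.

Lemma ideal_gen_min (A : nzRingType) (S I : set A) :
  two_sided_ideal I -> S `<=` I -> ideal_gen S `<=` I.
Proof. by move=> idI SI x; apply. Qed.

(** * Multiplication in the Toeplitz algebra *)

Section Toeplitz.
Context {K : fieldType}.
Local Notation T := (toeplitz K).
Local Notation v := (toeplitz_gen K Gv).
Local Notation w := (toeplitz_gen K Gw).
Local Notation e := (toeplitz_gen K Ge).
Local Notation f := (toeplitz_gen K Gf).
Local Notation es := (toeplitz_gen K Ges).
Local Notation fs := (toeplitz_gen K Gfs).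
Local Notation pi := (\pi_(toeplitz K)%qT).
Implicit Types x y a b : T.

Lemma pi_tvarM g h :
  pi (tvar K g * tvar K h) = toeplitz_gen K g * toeplitz_gen K h.
Proof. exact: pi_tmul. Qed.

Lemma pi_zero : pi 0 = 0.
Proof. exact: pi_zeror. Qed.

Lemma toeplitz_relM g h k : trelation (tvar K g * tvar K h) (tvar K k) ->
  toeplitz_gen K g * toeplitz_gen K h = toeplitz_gen K k.
Proof. by move=> /toeplitz_rel; rewrite pi_tvarM. Qed.

Lemma toeplitz_rel0 g h : trelation (tvar K g * tvar K h) 0 ->
  toeplitz_gen K g * toeplitz_gen K h = 0.
Proof. by move=> /toeplitz_rel; rewrite pi_tvarM pi_zero. Qed.

(** Left multiplication by generators, starting from [1], reaches all monomials,
    and these span the algebra. *)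
Lemma toeplitz_ind (P : T -> Prop) : P 0 ->
  (forall x y, P x -> P y -> P (x + y)) ->
  (forall (a : K) x, P x -> P (a *: x)) ->
  P 1 -> (forall g x, P x -> P (toeplitz_gen K g * x)) ->
  forall x, P x.
Proof.
move=> P0 PD PZ P1 PM x; rewrite -[x]generic_quotient.reprK.
rewrite [generic_quotient.repr x]monalgE.
elim: (X in \big[_/_]_(_ <- X) _) => [|m s IHs]; first by rewrite big_nil pi_zero.
rewrite big_cons pi_tD; apply: PD IHs; move: (_@_m) => c {s}.
have -> : << c *g m >> = c *: (<< m >> : tfree K).
  by apply/malgP => k; rewrite mcoeffZ !mcoeffU mulrnAr mulr1.
rewrite pi_tscale; apply: (PZ c).
case: m => s; elim: s => [|g s IH].
  by rewrite -fmoneE; exact: P1.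
have -> : << FMonom (g :: s) >> = tvar K g * << FMonom s >> :> tfree K.
  apply/esym/(etrans (fgmulUU _ _ _ _)); rewrite mulr1; congr << _ *g _ >>.
  by apply: val_inj; rewrite /= fmM fmU.
by rewrite pi_tmul; apply: PM.
Qed.

Lemma gen_1 : v + w = 1.
Proof. by rewrite -pi_tD -(toeplitz_rel (rel_1 K)). Qed.

Lemma gen_v : v = e * es + f * fs.
Proof. by rewrite -!pi_tvarM -pi_tD -(toeplitz_rel (rel_v K)). Qed.

Let ve : v * e = e. Proof. exact/toeplitz_relM/rel_ve. Qed.
Let vf : v * f = f. Proof. exact/toeplitz_relM/rel_vf. Qed.
Let fw : f * w = f. Proof. exact/toeplitz_relM/rel_fw. Qed.
Let esv : es * v = es. Proof. exact/toeplitz_relM/rel_esv. Qed.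
Let wfs : w * fs = fs. Proof. exact/toeplitz_relM/rel_wfs. Qed.
Let fsv : fs * v = fs. Proof. exact/toeplitz_relM/rel_fsv. Qed.
Let ese : es * e = v. Proof. exact/toeplitz_relM/rel_ese. Qed.
Let fsf : fs * f = w. Proof. exact/toeplitz_relM/rel_fsf. Qed.
Let ves : v * es = es. Proof. exact/toeplitz_relM/rel_ves. Qed.
Let ww : w * w = w. Proof. exact/toeplitz_relM/rel_ww. Qed.
Let wv : w * v = 0. Proof. exact/toeplitz_rel0/rel_wv. Qed.
Let we : w * e = 0. Proof. by rewrite -ve mulrA wv mul0r. Qed.
Let wf : w * f = 0. Proof. by rewrite -vf mulrA wv mul0r. Qed.
Let wes : w * es = 0. Proof. by rewrite -ves mulrA wv mul0r. Qed.
Let vw : v * w = 0. Proof. exact/toeplitz_rel0/rel_vw. Qed.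
Let esf : es * f = 0. Proof. exact/toeplitz_rel0/rel_esf. Qed.
Let fse : fs * e = 0. Proof. exact/toeplitz_rel0/rel_fse. Qed.
Let esw : es * w = 0. Proof. by rewrite -esv -mulrA vw mulr0. Qed.
Let fsw : fs * w = 0. Proof. by rewrite -fsv -mulrA vw mulr0. Qed.
Let esfs : es * fs = 0.
Proof. by rewrite -wfs mulrA esw mul0r. Qed.
Let fsfs : fs * fs = 0.
Proof. by rewrite -{2}wfs mulrA fsw mul0r. Qed.

(** * Commutators lie in the ideal of the sink *)

Local Notation F := (ideal_gen [set w]).

(** A commutator is controlled by commutators of generators, and all generators
    but [e] and [e^*] are in [F] or, for [v = 1 - w], congruent to [1]; what is
    left is [e e^* - e^* e = - f f^*]. *)
Lemma commutator_in_ideal_w x y : F (x * y - y * x).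
Proof.
have idF := ideal_genP [set w].
have [F0 FD FMl FMr] := idF.
have Fw : F w by apply: ideal_gen_sub.
have Ff : F f by rewrite -fw; apply: FMl.
have Ffs : F fs by rewrite -wfs; apply: FMr.
have FZ (a : K) z : F z -> F (a *: z).
  by move=> Fz; rewrite -[z]mul1r scalerAl; apply: FMl.
have comC a b : F (a * b - b * a) -> F (b * a - a * b).
  by move=> /(idealN idF); rewrite opprB.
have comI a : (forall h, F (a * toeplitz_gen K h - toeplitz_gen K h * a)) ->
    forall b, F (a * b - b * a).
  move=> Fa; elim/toeplitz_ind => [|b c Fb Fc|k b Fb||h b Fb].
  - by rewrite mulr0 mul0r subrr.
  - by rewrite mulrDr mulrDl opprD addrACA; apply: FD.
  - by rewrite -scalerAr -scalerAl -scalerBr; apply: FZ.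
  - by rewrite mulr1 mul1r subrr.
  - exact: (ideal_commutatorM idF).
have Cv a : F (v * a - a * v).
  have -> : v * a - a * v = a * w - w * a.
    rewrite -[v](addrK w) gen_1 mulrBl mulrBr.
    by rewrite mul1r mulr1 opprB addrC subrKA.
  by apply: comC; apply: (ideal_commutator idF).
have Cees : F (e * es - es * e).
  rewrite ese gen_v opprD addrA subrr sub0r.
  by apply: (idealN idF); apply: FMr.
have Cgen g : [\/ forall a, F (toeplitz_gen K g * a - a * toeplitz_gen K g),
                  g = Ge | g = Ges].
  by case: g; [constructor 1 => a; exact: Cv
    |constructor 1 => a; exact: (ideal_commutator idF)|constructor 2
    |constructor 1 => a; exact: (ideal_commutator idF)|constructor 3
    |constructor 1 => a; exact: (ideal_commutator idF)].
apply: (comI) => g; apply: (comC); have [Cg|->|->] := Cgen g; first exact: Cg.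
all: apply: (comI) => h; have [Ch|->|->] := Cgen h; first by apply: comC.
- by rewrite subrr.
- exact: Cees.
- exact: comC Cees.
- by rewrite subrr.
Qed.

(** * The ideal of the sink lies in the commutators *)

(** The monomials in [w T] that the relations do not shorten: [w], then
    [f^*], [f^* e^*], [f^* e^* e^*] and so on. *)
Definition ghost_word (n : nat) : T :=
  if n is m.+1 then fs * es ^+ m else w.

Lemma ghost_word_gen n g :
  ghost_word n * toeplitz_gen K g = 0 \/
  exists m, ghost_word n * toeplitz_gen K g = ghost_word m.
Proof.
case: n => [|[|n]]; rewrite /ghost_word.
- case: g; [left|right|left|left|left|right].
  + exact: wv.
  + by exists 0%N.
  + exact: we.
  + exact: wf.
  + exact: wes.
  + by exists 1%N; rewrite expr0 mulr1.
- rewrite expr0 mulr1; case: g; [right|left|left|right|right|left].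
  + by exists 1%N; rewrite expr0 mulr1.
  + exact: fsw.
  + exact: fse.
  + by exists 0%N.
  + by exists 2%N; rewrite expr1.
  + exact: fsfs.
- rewrite exprSr -!mulrA; case: g; [right|left|right|left|right|left].
  + by exists n.+2; rewrite esv exprSr.
  + by rewrite esw !mulr0.
  + exists n.+1; rewrite ese; case: n => [|n].
      by rewrite expr0 mul1r fsv mulr1.
    by rewrite exprSr -mulrA esv.
  + by rewrite esf !mulr0.
  + by exists n.+3; rewrite !exprSr -!mulrA.
  + by rewrite esfs !mulr0.
Qed.

(** Multiplying by [x] on the right moves along the ghost words, and
    multiplying by [w] kills all of them but [w] itself. *)
Lemma ghost_word_corner n x : exists c : K, ghost_word n * x * w = c *: w.
Proof.
elim/toeplitz_ind: x n => [|x y IHx IHy|a x IH||g x IH] n.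
- by exists 0; rewrite mulr0 mul0r scale0r.
- have [c cx] := IHx n; have [d dy] := IHy n; exists (c + d).
  by rewrite mulrDr mulrDl cx dy scalerDl.
- have [c cx] := IH n; exists (a * c).
  by rewrite -[_ * (a *: x)]scalerAr -scalerAl cx scalerA.
- rewrite mulr1; case: n => [|[|n]]; rewrite /ghost_word.
  + by exists 1; rewrite ww scale1r.
  + by exists 0; rewrite expr0 mulr1 fsw scale0r.
  + by exists 0; rewrite exprSr -!mulrA esw !mulr0 scale0r.
rewrite mulrA; have [->|[m ->]] := ghost_word_gen n g; last exact: IH.
by exists 0; rewrite !mul0r scale0r.
Qed.

Lemma corner_w x : exists c : K, w * x * w = c *: w.
Proof. exact: (ghost_word_corner 0). Qed.

(** Since [f f^* + e e^* = v = e^* e], only [f^* f = w] survives. *)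
Lemma commutator_expansion_w : w = (fs * f - f * fs) + (es * e - e * es).
Proof.
by rewrite fsf ese [X in _ + (X - _)]gen_v [e * es + _]addrC addrK subrK.
Qed.

Local Notation C := (lspan (commutators T)).

Lemma lspan_commutator a b : C (a * b - b * a).
Proof. by apply: sub_lspan; exists a, b. Qed.

Lemma ideal_w_in_commutators x : F x -> C x.
Proof.
have Cw : C w.
  by rewrite commutator_expansion_w; apply: lspanD; apply: lspan_commutator.
have CawB a b : C (a * w * b).
  (* Rotate the factor [w b] to the front. *)
  have -> : a * w * b = (a * w * (w * b) - w * b * (a * w)) + w * (b * a) * w.
    by rewrite -[a * w * (w * b)]mulrA [w * (w * b)]mulrA ww
      !mulrA subrK.
  apply: lspanD; first exact: lspan_commutator.
  by have [c ->] := corner_w (b * a); apply: lspanZ.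
(* The largest ideal contained in [C]. *)
pose J : set T := [set y | forall a b, C (a * y * b)].
move=> Fx; suff /(_ 1 1) : J x by rewrite mul1r mulr1.
apply: ideal_gen_min Fx => [|_ -> //].
split=> [a b|y z Jy Jz a b|c y Jy a b|c y Jy a b].
- by rewrite mulr0 mul0r; apply: lspan0.
- by rewrite mulrDr mulrDl; apply: lspanD.
- by rewrite mulrA.
- by rewrite mulrA -mulrA.
Qed.

End Toeplitz.

Theorem proposition4p2 (K : fieldType) :
  lspan (commutators (toeplitz K))
  = ideal_gen [set toeplitz_gen K Gw] :> set (toeplitz K).
Proof.
apply/seteqP; split; last exact: ideal_w_in_commutators.
have [F0 FD FM _] := ideal_genP [set toeplitz_gen K Gw].
apply: lspan_min => // [a x Fx|_ [a [b ->]]]; last exact: commutator_in_ideal_w.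
by rewrite -[x]mul1r scalerAl; apply: FM.
Qed.
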